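(* Let $\mathcal A$ be a unital $C^*$-algebra and let $E,F\subseteq l^2(\mathcal A)$ be bounded sets. The measure of noncompactness $\lambda$ has the following properties: (1) if $E\subseteq F$ then $\lambda(E)\le\lambda(F)$; (2) $\lambda(E\cap F)\le\min\{\lambda(E),\lambda(F)\}$; (3) $\lambda(E\cup F)\le\max\{\lambda(E),\lambda(F)\}$; (4) $\lambda(E+F)\le\lambda(E)+\lambda(F)$; (5) $\lambda(Ea)\le\lambda(E)\|a\|$ for every $a\in\mathcal A$. If, in addition, $a$ is invertible, then also $\|a^{-1}\|^{-1}\lambda(E)\le\lambda(Ea)$. In particular, when $a$ is unitary, $\lambda(Ea)=\lambda(E)$; (6) $\lambda(\operatorname{co}E)=\lambda(E)$, where $\operatorname{co}E=\{\sum_{i=1}^nt_ix_i \mid 0\le t_i\in\mathbb R,\ \sum_{i=1}^nt_i=1,\ x_i\in E\}$ is the convex hull of $E$.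
   Context: $l^2(\mathcal A)$ is the standard Hilbert $C^*$-module: the right $\mathcal A$-module of all sequences $x=(\xi_1,\xi_2,\dots)$ in $\mathcal A$ for which $\sum_{j}\xi_j^*\xi_j$ converges in norm, with $\mathcal A$-valued inner product $\langle x,y\rangle=\sum_j\xi_j^*\eta_j$ (for $y=(\eta_1,\eta_2,\dots)$) and norm $\|x\|=\|\langle x,x\rangle\|^{1/2}$. The module action is $(\xi_1,\xi_2,\dots)a=(\xi_1a,\xi_2a,\dots)$, $Ea=\{xa\mid x\in E\}$ and $E+F=\{x+y\mid x\in E,y\in F\}$. A free finitely generated submodule $M\le l^2(\mathcal A)$ is a closed $\mathcal A$-submodule isomorphic, as a Hilbert $\mathcal A$-module, to $\mathcal A^n$ for some $n\in\mathbb N$. For a bounded set $E\subseteq l^2(\mathcal A)$, $\lambda(E)$ is the greatest lower bound of all $\eta>0$ for which there is a free finitely generated submodule $M\le l^2(\mathcal A)$ with $\sup_{x\in E}\inf_{y\in M}\|x-y\|<\eta$. *)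

(* Defs.v *)
From HB Require Import structures.
From mathcomp Require Import all_boot all_order all_algebra.
From mathcomp Require Import complex.
From mathcomp Require Import all_classical all_reals all_analysis.

Set Implicit Arguments.
Unset Strict Implicit.
Unset Printing Implicit Defensive.

Import Order.TTheory GRing.Theory Num.Theory.
Import numFieldNormedType.Exports.

Local Open Scope classical_set_scope.
Local Open Scope ring_scope.

(* A unital C*-algebra is a complex Banach space with a product, a unit and an
   involution.  The ring laws are fields of the mixin, and the library's algebra
   structure is derived from them below, because a structure declared as a join
   of rings and normed modules would clash with [numDomainType]. *)
HB.mixin Record isCStarAlgebra (R : realType) A
    of CompleteNormedModule R[i] A := {
  amul : A -> A -> A;
  aone : A;
  star : A -> A;
  amulA : associative amul;
  amul1l : left_id aone amul;
  amul1r : right_id aone amul;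
  amulDl : left_distributive amul +%R;
  amulDr : right_distributive amul +%R;
  aone_neq0 : aone != 0;
  amulZl : forall (c : R[i]) (x y : A), amul (c *: x) y = c *: amul x y;
  amulZr : forall (c : R[i]) (x y : A), amul x (c *: y) = c *: amul x y;
  normM_le : forall x y : A, `|amul x y| <= `|x| * `|y|;
  starK : involutive star;
  starD : {morph star : x y / x + y};
  starZ : forall (c : R[i]) (x : A), star (c *: x) = conjc c *: star x;
  star_amul : forall x y : A, star (amul x y) = amul (star y) (star x);
  norm_star_amul : forall x : A, `|amul (star x) x| = `|x| ^+ 2
}.

#[short(type="cstarAlgType")]
HB.structure Definition CStarAlgebra (R : realType) :=
  {A of isCStarAlgebra R A & CompleteNormedModule R[i] A}.

Section CStarAlgebraInstances.
Context {R : realType} (A : cstarAlgType R).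

HB.instance Definition _ := GRing.Zmodule_isNzRing.Build A
  amulA amul1l amul1r amulDl amulDr aone_neq0.

Fact cstar_scalerAl (c : R[i]) (x y : A) : c *: (x * y) = (c *: x) * y.
Proof. by rewrite /GRing.mul /= amulZl. Qed.

HB.instance Definition _ := GRing.Lmodule_isLalgebra.Build R[i] A cstar_scalerAl.

Fact cstar_scalerAr (c : R[i]) (x y : A) : c *: (x * y) = x * (c *: y).
Proof. by rewrite /GRing.mul /= amulZr. Qed.

HB.instance Definition _ := GRing.Lalgebra_isAlgebra.Build R[i] A cstar_scalerAr.

End CStarAlgebraInstances.

Section HilbertModule.
Context {R : realType} {A : cstarAlgType R}.

(* The norm of a normed space over [R[i]] takes its values in [R[i]], where it
   is real and nonnegative; [cnorm] is the same number as an element of [R]. *)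
Definition cnorm (a : A) : R := complex.Re `|a|.

Definition unitary (a : A) : Prop := star a * a = 1 /\ a * star a = 1.

(* Elements of l^2(A) are sequences [nat -> A]; the sum and the scalar
   multiples are those of functions. *)
Definition l2 : set (nat -> A) :=
  [set x | cvgn (series (fun j => star (x j) * x j))].

Definition l2inner (x y : nat -> A) : A :=
  limn (series (fun j => star (x j) * y j)).

Definition l2norm (x : nat -> A) : R := Num.sqrt (cnorm (l2inner x x)).

Definition l2act (x : nat -> A) (a : A) : nat -> A := fun j => x j * a.

Definition l2bounded (E : set (nat -> A)) : Prop :=
  E `<=` l2 /\ exists C : R, forall x, E x -> l2norm x <= C.

Definition closed_submodule (M : set (nat -> A)) : Prop :=
  [/\ M `<=` l2,
      M 0,
      forall x y, M x -> M y -> M (x + y),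
      forall x a, M x -> M (l2act x a)
    & forall x, l2 x ->
        (forall e : R, 0 < e -> exists2 y, M y & l2norm (x - y) < e) -> M x].

(* The Hilbert module A^n. *)
Definition free_act n (u : 'rV[A]_n) (a : A) : 'rV[A]_n :=
  \row_i (u 0 i * a).

Definition free_inner n (u v : 'rV[A]_n) : A :=
  \sum_(i < n) star (u 0 i) * v 0 i.

Definition hilbert_iso n (M : set (nat -> A)) (f : 'rV[A]_n -> nat -> A) :
    Prop :=
  [/\ set_bij setT M f,
      forall u v, f (u + v) = f u + f v,
      forall u a, f (free_act u a) = l2act (f u) a
    & forall u v, l2inner (f u) (f v) = free_inner u v].

Definition free_fg_submodule (M : set (nat -> A)) : Prop :=
  closed_submodule M /\ exists (n : nat) (f : 'rV[A]_n -> nat -> A),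
    hilbert_iso M f.

Definition l2dist (x : nat -> A) (M : set (nat -> A)) : R :=
  inf [set l2norm (x - y) | y in M].

(* The inner supremum is taken in [\bar R], so that no junk value arises when
   it is not finite. *)
Definition lambda (E : set (nat -> A)) : R :=
  inf [set eta : R | 0 < eta /\ exists2 M, free_fg_submodule M &
         (ereal_sup [set (l2dist x M)%:E | x in E] < eta%:E)%E].

Definition set_act (E : set (nat -> A)) (a : A) : set (nat -> A) :=
  [set l2act x a | x in E].

Definition set_add (E F : set (nat -> A)) : set (nat -> A) :=
  [set x + y | x in E & y in F].

Definition co (E : set (nat -> A)) : set (nat -> A) :=
  [set z | exists (n : nat) (t : 'I_n -> R) (x : 'I_n -> nat -> A),
     [/\ forall i, 0 <= t i,
         \sum_(i < n) t i = 1,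
         forall i, E (x i)
       & z = \sum_(i < n) (real_complex R (t i)) *: x i]].

End HilbertModule.

(* Main.v *)
Require Import Defs.
From mathcomp Require Import all_boot all_order all_algebra.
From mathcomp Require Import complex.
From mathcomp Require Import all_classical all_reals all_analysis.
From mathcomp Require Import lra ring.

Import Order.TTheory GRing.Theory Num.Theory.
Import numFieldNormedType.Exports.

Local Open Scope classical_set_scope.
Local Open Scope ring_scope.

(** On a bounded set, every free finitely generated submodule M of l^2(A) is
    uniformly close to one of the standard modules A^k of sequences supported on
    the first k indices: the finitely many basis vectors of M have small tails,
    and the coordinates of y in M are bounded by the norm of y
    (near_free_bounded).  Hence, for bounded E, lambda E is the infimum of the
    nonnegative eta such that E lies within eta of some A^k (lambda_le, lambda_lt).  General free
    submodules are awkward to combine, since the sum of two of them need be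
    neither free nor closed, but the A^k form a chain.  Each assertion then
    follows by passing to the larger of two indices k and using the triangle
    inequality, |x a| <= |x| |a|, or convexity of balls; the reverse inequality
    for an invertible a is the direct one for its inverse.

    This argument rests on the norm of l^2(A) being a norm that dominates the
    norms of the coordinates.  Both facts are order properties of A: star x * x
    is positive (pos_star_mul), and 0 <= h <= k implies |h| <= |k|
    (pos_cnorm_le).  Self-adjoint h is called positive when |t - h| <= t for some t.  An
    explicit iteration provides square roots of such elements (sqrt_1B,
    pos_sqrt), and the identity star w * w = u^2 + v^2 for w = u + i v, where u
    and v are commuting and self-adjoint, gives monotonicity of the norm.
    Positivity of star x * x follows Kaplansky: its negative part yields an
    element y for which star y * y is the negative of a positive element, and
    such a y vanishes (star_mul_neg_eq0).  The triangle inequality comes from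
    |x + y|^2 <= (1 + t) |x|^2 + (1 + 1/t) |y|^2 by optimizing t. *)

(** * The real-valued norm of a C*-algebra *)

Section Norm.
Local Open Scope complex_scope.
Context {R : realType} {A : cstarAlgType R}.
Implicit Types (x y z : A) (r t : R).

Lemma normE x : `|x| = (cnorm x)%:C.
Proof. by rewrite /cnorm RRe_real // ger0_real. Qed.

Lemma cnorm_ge0 x : 0 <= cnorm x.
Proof. by rewrite -ler0c -normE. Qed.

Lemma cnorm0 : cnorm (0 : A) = 0.
Proof. by rewrite /cnorm normr0. Qed.

Lemma cnorm_eq0 x : cnorm x = 0 -> x = 0.
Proof. by move=> h; apply/eqP; rewrite -normr_eq0 normE h. Qed.

Lemma cnormN x : cnorm (- x) = cnorm x.
Proof. by rewrite /cnorm normrN. Qed.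

Lemma cnormD x y : cnorm (x + y) <= cnorm x + cnorm y.
Proof. by rewrite -lecR rmorphD /= -!normE ler_normD. Qed.

Lemma cnormB x y : cnorm (x - y) <= cnorm x + cnorm y.
Proof. by rewrite -(cnormN y) cnormD. Qed.

Lemma cnormC x y : cnorm (x - y) = cnorm (y - x).
Proof. by rewrite -cnormN opprB. Qed.

Lemma cnormM x y : cnorm (x * y) <= cnorm x * cnorm y.
Proof. by rewrite -lecR rmorphM /= -!normE normM_le. Qed.

Lemma cnormZ (r : R) x : cnorm (r%:C *: x) = `|r| * cnorm x.
Proof.
apply: (@complexI R); rewrite rmorphM /= -!normE normrZ; congr (_ * _).
by rewrite normc_def /= expr0n addr0 sqrtr_sqr.
Qed.

Lemma cnorm_star_mul x : cnorm (star x * x) = cnorm x ^+ 2.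
Proof.
by apply: (@complexI R); rewrite rmorphXn /= -!normE (norm_star_amul x).
Qed.

Lemma starM x y : star (x * y) = star y * star x.
Proof. exact: star_amul. Qed.

Lemma star0 : star (0 : A) = 0.
Proof. by apply: (@addrI _ (star 0)); rewrite -starD !addr0. Qed.

Lemma starN x : star (- x) = - star x.
Proof. by apply: (@addrI _ (star x)); rewrite -starD !subrr star0. Qed.

Lemma starB x y : star (x - y) = star x - star y.
Proof. by rewrite starD starN. Qed.

Lemma star1 : star (1 : A) = 1.
Proof. by rewrite -[LHS]mulr1 -{2}(starK (1 : A)) -starM mulr1 starK. Qed.

Lemma starZr (r : R) x : star (r%:C *: x) = r%:C *: star x.
Proof. by rewrite starZ conjc_real. Qed.

(** The C*-identity gives |y|^2 <= |star y| |y|, hence one inequality; the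
    other is the same statement for star y. *)
Lemma cnorm_star x : cnorm (star x) = cnorm x.
Proof.
suff H y : cnorm y <= cnorm (star y).
  by apply/le_anti; rewrite H /= -{2}(starK x) H.
case: (ltrP 0 (cnorm y)) => [y0|]; last first.
  by move/le_trans; apply; exact: cnorm_ge0.
by rewrite -(ler_pM2r y0) -expr2 -cnorm_star_mul cnormM.
Qed.

Lemma cnorm1 : cnorm (1 : A) = 1.
Proof.
have := cnorm_star_mul 1; rewrite star1 mulr1 => h.
have n0 : cnorm (1 : A) != 0 by apply/eqP => /cnorm_eq0 /eqP; rewrite oner_eq0.
by apply: (mulIf n0); rewrite mul1r -expr2.
Qed.

Lemma cnorm_sqr x : star x = x -> cnorm (x * x) = cnorm x ^+ 2.
Proof. by move=> xs; rewrite -{1}xs cnorm_star_mul. Qed.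

Lemma mulrZ r x y : x * (r%:C *: y) = r%:C *: (x * y).
Proof. by rewrite -scalerAr. Qed.

Lemma mulZr r x y : (r%:C *: x) * y = r%:C *: (x * y).
Proof. by rewrite -scalerAl. Qed.

Lemma half_addrr x : (2^-1 : R)%:C *: (x + x) = x.
Proof.
rewrite scalerDr -scalerDl -rmorphD /=.
have -> : 2^-1 + 2^-1 = 1 :> R by lra.
by rewrite (rmorph1 (real_complex R)) scale1r.
Qed.

Lemma gt0_realP (e : R[i]) : 0 < e -> exists2 r : R, 0 < r & e = r%:C.
Proof.
move=> e0; exists (complex.Re e); last by rewrite RRe_real // gtr0_real.
by move: e0; rewrite ltcE => /andP[].
Qed.

Lemma cvg_cnormP (u : nat -> A) (l : A) :
  u @ \oo --> l <->
  forall e : R, 0 < e -> exists N, forall n, (N <= n)%N -> cnorm (l - u n) < e.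
Proof.
split=> [/cvgrPdist_lt h e e0|h].
  have [|N _ HN] := h e%:C; first by rewrite ltcR.
  by exists N => n /HN /=; rewrite normE ltcR.
apply/cvgrPdist_lt => e /gt0_realP[r /h[N HN] ->].
by exists N => // n /= /HN; rewrite normE ltcR.
Qed.

(** Completeness of A, which the square root below and the sum of two
    elements of l^2(A) rely on. *)
Lemma cauchy_cnorm_cvg (u : nat -> A) :
  (forall e : R, 0 < e -> exists N, forall n, (N <= n)%N -> cnorm (u n - u N) < e)
  -> cvgn u.
Proof.
move=> h; apply: cauchy_cvg; apply: cauchy_exP => e /gt0_realP[r /h[N HN] ->].
exists (u N); exists N => // n /= /HN.
by rewrite -ball_normE /= normE ltcR cnormC.
Qed.

Lemma cvg_cnorm_cauchy (u : nat -> A) : cvgn u ->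
  forall e : R, 0 < e -> exists N, forall m n, (N <= m)%N -> (N <= n)%N ->
    cnorm (u n - u m) < e.
Proof.
move=> /cvg_cnormP h e e0; have [|N HN] := h (e / 2); first by rewrite divr_gt0.
exists N => m n /HN hm /HN hn.
have -> : u n - u m = (limn u - u m) - (limn u - u n).
  by rewrite opprB [RHS]addrC subrKA.
by apply: le_lt_trans (cnormB _ _) _; rewrite [ltRHS]splitr ltrD.
Qed.
End Norm.

(** * Square roots of elements close to 1 *)

Section SquareRoot.
Local Open Scope complex_scope.
Context {R : realType} {A : cstarAlgType R}.
Implicit Types (x y z : A).

(** Picard iterates for y = (x + y^2) / 2, an equation equivalent to
    (1 - y)^2 = 1 - x. *)
Fixpoint sqrt_iter x n : A :=
  if n is m.+1 then (2^-1 : R)%:C *: (x + sqrt_iter x m * sqrt_iter x m) else 0.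

Fixpoint sqrt_bound n : R :=
  if n is m.+1 then (1 + sqrt_bound m ^+ 2) / 2 else 0.

Lemma sqrt_bound_itv n : 0 <= sqrt_bound n <= 1.
Proof. by elim: n => [|n /andP[h0 h1]] /=; [rewrite lexx ler01|apply/andP; nra]. Qed.

Lemma sqrt_bound_nd : nondecreasing_seq sqrt_bound.
Proof.
apply/nondecreasing_seqP => n /=; have := sqr_ge0 (1 - sqrt_bound n); lra.
Qed.

Lemma eq_of_cnorm_le x y (C : R) :
  (forall e : R, 0 < e -> cnorm (x - y) <= C * e) -> x = y.
Proof.
move=> h; apply/subr0_eq/cnorm_eq0/le_anti; rewrite cnorm_ge0 andbT.
apply/ler_addgt0Pr => e e0; rewrite add0r.
have C0 : 0 < `|C| + 1 by rewrite ltr_wpDl.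
apply: le_trans (h (e / (`|C| + 1)) _) _; first exact: divr_gt0.
rewrite mulrCA ler_piMr // ?(ltW e0) // ler_pdivrMr // mul1r.
by rewrite ler_wpDr // ler_norm.
Qed.

Lemma cnorm_half x y :
  cnorm ((2^-1 : R)%:C *: x - (2^-1 : R)%:C *: y) = cnorm (x - y) / 2.
Proof. by rewrite -scalerBr cnormZ gtr0_norm ?invr_gt0 // mulrC. Qed.

(** The iterates are polynomials in x with nonnegative coefficients, and so are
    their increments; for |x| <= 1 both are therefore dominated by their values
    at the real number 1.  This gives convergence up to the boundary |x| = 1,
    where the iteration is no longer a contraction. *)
Lemma cnorm_sqrt_iter x n : cnorm x <= 1 ->
  cnorm (sqrt_iter x n) <= sqrt_bound n /\
  cnorm (sqrt_iter x n.+1 - sqrt_iter x n) <= sqrt_bound n.+1 - sqrt_bound n.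
Proof.
move=> x1; have N m : cnorm (sqrt_iter x m) <= sqrt_bound m.
  elim: m => [|m IH] /=; first by rewrite cnorm0.
  rewrite cnormZ gtr0_norm ?invr_gt0 // mulrC ler_pM2r ?invr_gt0 //.
  apply: le_trans (cnormD _ _) (lerD x1 _).
  apply: le_trans (cnormM _ _) _; rewrite expr2.
  by apply: ler_pM => //; exact: cnorm_ge0.
split=> //; elim: n => [|n IH].
  rewrite /= mul0r addr0 subr0 cnormZ gtr0_norm ?invr_gt0 // expr2 mul0r.
  by rewrite addr0 subr0 mulrC ler_pM2r ?invr_gt0.
set u := sqrt_iter x n.+1 in IH *; set v := sqrt_iter x n in IH *.
have -> : sqrt_iter x n.+2 - u = (2^-1 : R)%:C *: (u * (u - v) + (u - v) * v).
  rewrite mulrBr mulrBl subrKA -[sqrt_iter x n.+2]/(_ *: (x + u * u)).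
  rewrite -[X in _ - X]/((2^-1 : R)%:C *: (x + v * v)) -scalerBr opprD addrACA.
  by rewrite subrr add0r.
rewrite cnormZ gtr0_norm ?invr_gt0 //.
have h1 := cnormD (u * (u - v)) ((u - v) * v).
have h2 := cnormM u (u - v); have h3 := cnormM (u - v) v.
have h4 := N n.+1; have h5 := N n; have /andP[h6 _] := sqrt_bound_itv n.
have /andP[h7 _] := sqrt_bound_itv n.+1.
have h8 := cnorm_ge0 (u - v).
have -> : sqrt_bound n.+2 - sqrt_bound n.+1 =
  2^-1 * ((sqrt_bound n.+1 + sqrt_bound n) * (sqrt_bound n.+1 - sqrt_bound n)).
  by rewrite /=; field.
rewrite ler_pM2l ?invr_gt0 //; apply: le_trans h1 _.
apply: le_trans (lerD h2 h3) _; rewrite mulrC -mulrDr mulrC.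
by apply: ler_pM; rewrite ?addr_ge0 ?cnorm_ge0 // lerD.
Qed.

Lemma cvg_sqrt_iter x : cnorm x <= 1 -> cvgn (sqrt_iter x).
Proof.
move=> x1; apply: cauchy_cnorm_cvg => e e0.
have bc : cvgn sqrt_bound.
  apply: nondecreasing_is_cvgn; first exact: sqrt_bound_nd.
  by exists 1 => _ [n _ <-]; case/andP: (sqrt_bound_itv n).
have /cvgrPdist_lt /(_ e e0) [N _ /(_ N (leqnn _)) HN] := bc.
exists N => n /subnK <-; set k := (n - N)%N.
have le_l m : sqrt_bound m <= limn sqrt_bound.
  exact: nondecreasing_cvgn_le sqrt_bound_nd bc m.
rewrite /= ger0_norm ?subr_ge0 // in HN.
apply: le_lt_trans _ HN; apply: le_trans _ (lerB (le_l (k + N)%N) (lexx _)).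
elim: k => [|k IH]; first by rewrite add0n !subrr cnorm0.
rewrite addSn -(subrKA (sqrt_iter x (k + N))).
apply: le_trans (cnormD _ _) _.
rewrite -[leRHS](subrKA (sqrt_bound (k + N))) lerD //.
by case: (cnorm_sqrt_iter x (k + N) x1).
Qed.

(** All properties of the limit pass from the iterates, which are polynomials
    in x.  Commutation with everything that commutes with x replaces the
    statement that the root lies in the C*-algebra generated by x. *)
Lemma sqrt_1B x : star x = x -> cnorm x <= 1 ->
  exists y, [/\ star y = y, cnorm y <= 1, (1 - y) * (1 - y) = 1 - x &
    forall z, z * x = x * z -> z * y = y * z].
Proof.
move=> xs x1; have /cvg_cnormP := cvg_sqrt_iter x x1.
set y := limn _ => cy; exists y; set u := sqrt_iter x in cy.
have un n : cnorm (u n) <= 1.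
  have [h _] := cnorm_sqrt_iter x n x1; apply: le_trans h _.
  by case/andP: (sqrt_bound_itv n).
have us n : star (u n) = u n.
  by elim: n => [|n IH] /=; rewrite ?star0 // starZr starD starM xs IH.
have y1 : cnorm y <= 1.
  apply/ler_addgt0Pr => e /cy[N /(_ N (leqnn _)) /ltW h].
  by rewrite -(subrK (u N) y) addrC (le_trans (cnormD _ _)) // lerD.
split=> //.
- apply: (@eq_of_cnorm_le _ _ 2) => e /cy[N /(_ N (leqnn _)) /ltW h].
  have -> : star y - y = star (y - u N) - (y - u N).
    by rewrite starB us opprB addrA subrK.
  by apply: le_trans (cnormB _ _) _; rewrite cnorm_star; lra.
- suff h : y = (2^-1 : R)%:C *: (x + y * y).
    have h2 : y + y = x + y * y by rewrite {1 2}h -scalerDr half_addrr.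
    have -> : x = y + y - y * y by rewrite h2 addrK.
    by rewrite mulrBl mul1r mulrBr mulr1 !opprB opprD -addrA [- y + _]addrCA.
  apply: (@eq_of_cnorm_le _ _ 2) => e /cy[N HN].
  have /ltW h := HN N (leqnn _); have /ltW h' := HN N.+1 (leqnSn _).
  rewrite -(subrKA (u N.+1)); apply: le_trans (cnormD _ _) _.
  suff : cnorm (u N.+1 - (2^-1 : R)%:C *: (x + y * y)) <= e by lra.
  rewrite {1}/u /= -/u cnorm_half opprD addrACA subrr add0r.
  have -> : u N * u N - y * y = - (y * (y - u N) + (y - u N) * u N).
    by rewrite mulrBr mulrBl subrKA opprB.
  rewrite cnormN; have h1 := cnormD (y * (y - u N)) ((y - u N) * u N).
  have h2 := cnormM y (y - u N); have h3 := cnormM (y - u N) (u N).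
  have := cnorm_ge0 (y - u N); have := cnorm_ge0 y; have := cnorm_ge0 (u N).
  have := un N; nra.
- move=> z zx; have zu n : z * u n = u n * z.
    elim: n => [|n IH] /=; first by rewrite mulr0 mul0r.
    by rewrite mulrZ mulZr mulrDr mulrDl zx mulrA IH -!mulrA IH.
  apply: (@eq_of_cnorm_le _ _ (2 * cnorm z)) => e /cy[N /(_ N (leqnn _)) /ltW h].
  have -> : z * y - y * z = z * (y - u N) - (y - u N) * z.
    by rewrite mulrBr mulrBl zu opprB addrA subrK.
  apply: le_trans (cnormB _ _) _.
  have := cnormM z (y - u N); have := cnormM (y - u N) z.
  have := cnorm_ge0 z; nra.
Qed.
End SquareRoot.

(** * Positive elements *)

Section Positivity.
Local Open Scope complex_scope.
Context {R : realType} {A : cstarAlgType R}.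
Implicit Types (x y z h k u v : A) (r s t c : R).

Definition sc (r : R) : A := r%:C%:A.

Lemma scD r s : sc (r + s) = sc r + sc s.
Proof. by rewrite /sc rmorphD /= scalerDl. Qed.

Lemma scM r x : sc r * x = r%:C *: x.
Proof. by rewrite /sc mulZr mul1r. Qed.

Lemma scC r x : x * sc r = sc r * x.
Proof. by rewrite scM /sc mulrZ mulr1. Qed.

Lemma scMM r s : sc r * sc s = sc (r * s).
Proof. by rewrite scM /sc scalerA -rmorphM. Qed.

Lemma sc0 : sc 0 = 0.
Proof. by rewrite /sc (rmorph0 (real_complex R)) scale0r. Qed.

Lemma sc1 : sc 1 = 1.
Proof. by rewrite /sc (rmorph1 (real_complex R)) scale1r. Qed.

Lemma star_sc r : star (sc r) = sc r.
Proof. by rewrite /sc starZr star1. Qed.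

Lemma cnorm_sc r : cnorm (sc r) = `|r|.
Proof. by rewrite /sc cnormZ cnorm1 mulr1. Qed.

Lemma cnorm_scM r x : cnorm (sc r * x) = `|r| * cnorm x.
Proof. by rewrite scM cnormZ. Qed.

Lemma scMA r s x : sc r * (sc s * x) = sc (r * s) * x.
Proof. by rewrite mulrA scMM. Qed.

Lemma sc1M x : sc 1 * x = x.
Proof. by rewrite sc1 mul1r. Qed.

Lemma mul_scA r x y : x * (sc r * y) = sc r * (x * y).
Proof. by rewrite mulrA scC mulrA. Qed.

(** The inequality |t - h| <= t confines the spectrum of h to [0, 2t].  In this
    form, positivity of sums and of nonnegative multiples is the triangle
    inequality and homogeneity of the norm. *)
Definition pos h : Prop := star h = h /\ exists t, cnorm (sc t - h) <= t.

Lemma posD h k : pos h -> pos k -> pos (h + k).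
Proof.
move=> [hs [t ht]] [ks [s kt]]; split; first by rewrite starD hs ks.
exists (t + s); rewrite scD opprD addrACA.
by apply: le_trans (cnormD _ _) _; rewrite lerD.
Qed.

Lemma posM r h : 0 <= r -> pos h -> pos (sc r * h).
Proof.
move=> r0 [hs [t ht]]; split; first by rewrite starM hs star_sc scC.
by exists (r * t); rewrite -scMM -mulrBr cnorm_scM ger0_norm // ler_wpM2l.
Qed.

Lemma pos_subsc h c : star h = h -> cnorm h <= c -> pos (sc c - h).
Proof.
move=> hs hc; split; first by rewrite starB star_sc hs.
by exists c; rewrite subKr.
Qed.

Lemma pos_sc c : 0 <= c -> pos (sc c).
Proof.
move=> c0; rewrite -(subr0 (sc c)); by apply: pos_subsc; rewrite ?star0 ?cnorm0.
Qed.

(** Apply sqrt_1B to x = 1 - h / t, which has norm at most 1 exactly when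
    |t - h| <= t. *)
Lemma pos_sqrt h : pos h -> exists k,
  [/\ pos k, k * k = h & forall z, z * h = h * z -> z * k = k * z].
Proof.
move=> [hs [t ht]]; have t0 : 0 <= t := le_trans (cnorm_ge0 _) ht.
move: t0 ht; rewrite le_eqVlt => /orP[/eqP <- |t0 ht].
  rewrite sc0 sub0r cnormN => h0; exists 0.
  have -> : h = 0 by apply/cnorm_eq0/le_anti; rewrite h0 cnorm_ge0.
  split=> [||z _]; rewrite ?mulr0 ?mul0r //.
  by rewrite -sc0; exact: pos_sc.
have tn0 := lt0r_neq0 t0.
have [||y [ys y1 y2 yC]] := @sqrt_1B _ A (1 - sc t^-1 * h).
- by rewrite starB star1 starM star_sc hs scC.
- have -> : 1 - sc t^-1 * h = sc t^-1 * (sc t - h).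
    by rewrite mulrBr scMM mulVf // sc1.
  by rewrite cnorm_scM gtr0_norm ?invr_gt0 // mulrC ler_pdivrMr // mul1r.
exists (sc (Num.sqrt t) * (1 - y)); split.
- split; first by rewrite starM starB star1 ys star_sc scC.
  exists (Num.sqrt t); rewrite mulrBr mulr1 subKr cnorm_scM.
  by rewrite ger0_norm ?sqrtr_ge0 // ler_piMr ?sqrtr_ge0.
- rewrite mul_scA -mulrA y2 scMA -expr2 sqr_sqrtr ?(ltW t0) //.
  by rewrite subKr scMA mulfV // sc1M.
- move=> z zh; rewrite mul_scA -mulrA mulrBr mulrBl mulr1 mul1r yC //.
  by rewrite mulrBr mulrBl mulr1 mul1r mul_scA zh mulrA.
Qed.

Lemma imagZZ x : 'i%C *: ('i%C *: x) = - x.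
Proof.
rewrite scalerA -scaleN1r; congr (_ *: _).
by apply/eqP; rewrite eq_complex /= !mulr0 !mul0r mulr1 sub0r addr0 oppr0 !eqxx.
Qed.

(** For w = u + i v one has star w * w = u^2 + v^2, so |w|^2 is the right-hand
    side, and u is the average of w and star w, which have the same norm. *)
Lemma cnorm_sqr_le u v : star u = u -> star v = v -> u * v = v * u ->
  cnorm u ^+ 2 <= cnorm (u * u + v * v).
Proof.
move=> us vs uv; pose w := u + 'i%C *: v.
have ws : star w = u - 'i%C *: v.
  rewrite /w starD starZ us vs -scaleNr; congr (_ + _ *: _).
  by apply/eqP; rewrite eq_complex /= oppr0 !eqxx.
have <- : star w * w = u * u + v * v.
  rewrite ws /w mulrDr !mulrBl -!scalerAr -!scalerAl uv subrKA.
  by rewrite imagZZ opprK.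
rewrite cnorm_star_mul ler_pXn2r ?nnegrE ?cnorm_ge0 //.
have -> : u = (2^-1 : R)%:C *: (w + star w).
  by rewrite ws /w addrACA subrr addr0 half_addrr.
rewrite cnormZ gtr0_norm ?invr_gt0 // mulrC ler_pdivrMr // mulrC.
by apply: le_trans (cnormD _ _) _; rewrite cnorm_star mulr2n mulrDl mul1r.
Qed.

(** Writing h = u^2 and c - h = v^2 with commuting roots, u^2 + v^2 = c, and
    cnorm_sqr_le bounds |h| = |u|^2. *)
Lemma pos_le_cnorm h c : pos h -> pos (sc c - h) -> 0 <= c -> cnorm h <= c.
Proof.
move=> hp kp c0; have [u [[us _] uu uC]] := pos_sqrt _ hp.
have [v [[vs _] vv vC]] := pos_sqrt _ kp.
have := @cnorm_sqr_le u v us vs; rewrite uu vv addrCA subrr addr0 cnorm_sc.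
rewrite ger0_norm // -cnorm_sqr // uu; apply.
by apply: vC; rewrite mulrBr mulrBl scC -uu mulrA.
Qed.

Lemma pos_cnorm_le h k : pos h -> pos (k - h) -> cnorm h <= cnorm k.
Proof.
move=> hp kp; apply: pos_le_cnorm; rewrite ?cnorm_ge0 //.
have ks : star k = k by have := (posD _ _ hp kp).1; rewrite addrC subrK.
rewrite -(subrKA k).
exact: (posD _ _ (pos_subsc _ _ ks (lexx _)) kp).
Qed.

(** With c = |u^2|, the element c - u^2 is positive, so it is v^2 for some v
    commuting with u; then |v|^2 <= |u^2 + v^2| = c, which is the norm
    inequality defining positivity of u^2. *)
Lemma pos_sqr u : star u = u -> pos (u * u).
Proof.
move=> us; split; first by rewrite starM us.
exists (cnorm u ^+ 2); rewrite -cnorm_sqr //.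
have [|v [[vs _] vv vC]] := pos_sqrt (sc (cnorm (u * u)) - u * u).
  by apply: pos_subsc; rewrite ?starM ?us.
rewrite -vv cnorm_sqr //.
have := @cnorm_sqr_le v u vs us; rewrite vv subrK cnorm_sc ger0_norm ?cnorm_ge0 //.
by apply; rewrite vC // mulrBr mulrBl scC mulrA.
Qed.


(** With a = y + star y and b = i (star y - y), both self-adjoint, the given
    element is (a^2 + b^2) / 2. *)
Lemma pos_star_mul_swap y : pos (y * star y + star y * y).
Proof.
pose a := y + star y; pose b := 'i%C *: (star y - y).
have as_ : star a = a by rewrite /a starD starK addrC.
have bs : star b = b.
  rewrite /b starZ starB starK -opprB scalerN -scaleNr; congr (_ *: _).
  by apply/eqP; rewrite eq_complex /= oppr0 opprK !eqxx.
have h0 : 0 <= 2^-1 :> R by rewrite invr_ge0.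
have := posM _ _ h0 (posD _ _ (pos_sqr _ as_) (pos_sqr _ bs)).
rewrite scM; congr (pos _).
rewrite -[RHS]half_addrr; congr (_ *: _).
rewrite /b -scalerAl -scalerAr imagZZ /a.
set s := star y.
have -> : (y + s) * (y + s) = (y * s + s * y) + (y * y + s * s).
  by rewrite mulrDl !mulrDr (AC (2*2) ((2*3)*(1*4))).
have -> : (s - y) * (s - y) = (y * y + s * s) - (y * s + s * y).
  by rewrite mulrBl !mulrBr opprB opprD (AC (2*2) ((3*1)*(4*2))).
by rewrite opprB addrACA subrr addr0.
Qed.

(** The element p = y * star y is q plus a positive element, hence positive, and
    its norm is N = |y|^2, so |N - p| <= N.  Sandwiching N - p between star y and
    y bounds |N q + q^2| by N^2, and completing the square with (q - N)^2 >= 0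
    turns this into 3 N q <= 2 N^2.  Since |q| = N, this forces N = 0. *)
Lemma star_mul_neg_eq0 y (q : A) : pos q -> star y * y = - q -> y = 0.
Proof.
move=> rp yr; have [rs _] := rp; pose N := cnorm y ^+ 2.
have rN : cnorm q = N by rewrite -cnormN -yr cnorm_star_mul.
have NE : N = cnorm y * cnorm y by [].
have N0 : 0 <= N by rewrite sqr_ge0.
clearbody N.
pose p := y * star y.
have pp : pos p.
  have -> : p = y * star y + star y * y + q by rewrite yr addrNK.
  exact: posD (pos_star_mul_swap y) rp.
have pN : cnorm p = N by rewrite /p -{1}(starK y) cnorm_star_mul cnorm_star.
have qN : cnorm (sc N - p) <= N.
  apply: pos_le_cnorm => //; rewrite ?subKr //.
  by apply: pos_subsc; rewrite ?pN //; case: pp.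
have gE : star y * (sc N - p) * y = - (sc N * q + q * q).
  rewrite mulrBr mulrBl scC /p -!mulrA [star y * (y * _)]mulrA yr.
  by rewrite mulrN mulNr opprK opprD mulrN.
have gN : cnorm (sc N * q + q * q) <= N ^+ 2.
  rewrite -cnormN -gE; apply: le_trans (cnormM _ _) _.
  have -> : N ^+ 2 = N * cnorm y * cnorm y by rewrite -mulrA -NE.
  rewrite ler_wpM2r ?cnorm_ge0 //.
  apply: le_trans (cnormM _ _) _; rewrite cnorm_star mulrC.
  by rewrite ler_wpM2r ?cnorm_ge0.
have h1 : pos (sc (N ^+ 2) - (sc N * q + q * q)).
  by apply: pos_subsc; rewrite // starD !starM rs star_sc scC.
have h2 : pos ((q - sc N) * (q - sc N)) by apply: pos_sqr; rewrite starB rs star_sc.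
have h3 := posD _ _ h1 h2.
have h4 : cnorm (sc (3 * N) * q) <= 2 * N ^+ 2.
  apply: pos_le_cnorm; rewrite ?mulr_ge0 ?sqr_ge0 //.
    by apply: posM; rewrite ?mulr_ge0.
  move: h3; set M := N ^+ 2; set X := sc N * q.
  have -> : (q - sc N) * (q - sc N) = (sc M - (X + X)) + q * q.
    rewrite mulrBl !mulrBr scC -/X scMM -expr2 -/M opprB opprD.
    by rewrite (AC (2*2) ((3*(2*4))*1)).
  have -> : sc (2 * M) = sc M + sc M by rewrite -scD; congr sc; lra.
  have -> : sc (3 * N) * q = X + (X + X).
    by rewrite /X -!mulrDl -!scD; congr (sc _ * _); lra.
  congr (pos _); rewrite [- (X + q * q)]opprD [- (X + (X + X))]opprD.
  by rewrite [LHS](AC ((1*2)*(2*1)) (((1*4)*(2*5))*(6*3))) /= subrr addr0.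
apply/cnorm_eq0/eqP; rewrite -sqrf_eq0 expr2 -NE.
rewrite cnorm_scM rN ger0_norm ?mulr_ge0 // in h4.
by apply/eqP; have := sqr_ge0 N; rewrite expr2 in h4 *; nra.
Qed.

(** Let h = star x * x, let k be the positive root of h^2 (that is, |h|), and
    m = k - h (twice the negative part of h).  Then h m = - k m, so that
    star (x m) * (x m) = m h m = - m k m is the negative of a positive element.
    Hence x m = 0, whence m k m = 0, m^4 = 0, m = 0 and h = k. *)
Theorem pos_star_mul x : pos (star x * x).
Proof.
pose h := star x * x; rewrite -/h.
have hs : star h = h by rewrite /h starM starK.
have [k [kp kk kC]] := pos_sqrt (h * h) (pos_sqr h hs).
have ks : star k = k by case: kp.
have hk : h * k = k * h by apply: kC; rewrite mulrA.
have [s [[ss _] sk sC]] := pos_sqrt k kp.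
pose m := k - h; have ms : star m = m by rewrite starB ks hs.
have hm : h * m = - (k * m) by rewrite !mulrBr kk hk opprB.
have km : k * m = m * k by rewrite mulrBr mulrBl hk.
have sm : s * m = m * s.
  by rewrite -sC // mulrBr mulrBl hk.
have mkm : m * (k * m) = 0.
  have : x * m = 0.
    apply: (star_mul_neg_eq0 _ ((s * m) * (s * m))).
      by apply: pos_sqr; rewrite starM ms ss sm.
    rewrite starM ms -mulrA [star x * _]mulrA -/h hm mulrN.
    by rewrite {1}sm -mulrA [s * (s * m)]mulrA sk.
  move/(congr1 (fun z => star x * z)); rewrite mulrA -/h hm mulr0.
  by move/eqP; rewrite oppr_eq0 => /eqP ->; rewrite mulr0.
have mm : m * m = k * m + k * m.
  by rewrite {1}/m mulrBl hm opprK.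
have mmmm : (m * m) * (m * m) = 0.
  by rewrite {2}mm mulrDr -mulrA mkm mulr0 addr0.
have m0 : m = 0.
  apply/cnorm_eq0/eqP; rewrite -sqrf_eq0 -cnorm_sqr // -sqrf_eq0 -cnorm_sqr.
    by rewrite mmmm cnorm0.
  by rewrite starM ms.
by move/subr0_eq: m0 => <-.
Qed.

End Positivity.

(** * The norm of l^2(A) *)

Section L2.
Local Open Scope complex_scope.
Context {R : realType} {A : cstarAlgType R}.
Implicit Types (x y z : nat -> A) (a b : A) (m n k : nat) (c e r t : R).

Definition sqsum x m n : A := \sum_(m <= j < n) star (x j) * x j.

(** The l^2 norm of the block of x over the indices m <= j < n.  Membership in
    l^2(A) and the norm of l^2(A) are both expressed through such blocks, so
    that all inequalities need only be proved for finite sums. *)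
Definition wnorm x m n : R := Num.sqrt (cnorm (sqsum x m n)).

Lemma pos_sqsum x m n : pos (sqsum x m n).
Proof.
apply: (big_ind pos) => [|h k|j _]; first by rewrite -sc0; exact: pos_sc.
  exact: posD.
exact: pos_star_mul.
Qed.

Lemma sqsum_cat x m k n : (m <= k <= n)%N ->
  sqsum x m n = sqsum x m k + sqsum x k n.
Proof. by move=> /andP[mk kn]; rewrite /sqsum (big_cat_nat mk kn). Qed.

Lemma wnorm_ge0 x m n : 0 <= wnorm x m n.
Proof. exact: sqrtr_ge0. Qed.

Lemma wnorm_sqr x m n : wnorm x m n ^+ 2 = cnorm (sqsum x m n).
Proof. by rewrite sqr_sqrtr ?cnorm_ge0. Qed.

(** This is where positivity of star (x j) * x j enters: removing terms from the
    sum decreases the norm. *)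
Lemma wnorm_le x m n m' n' : (m' <= m)%N -> (n <= n')%N ->
  wnorm x m n <= wnorm x m' n'.
Proof.
move=> mm nn; case: (leqP m n) => [mn|/ltnW nm]; last first.
  by rewrite /wnorm {1}/sqsum big_geq // cnorm0 sqrtr0 sqrtr_ge0.
rewrite ler_sqrt ?cnorm_ge0 //; apply: pos_cnorm_le (pos_sqsum _ _ _) _.
rewrite (sqsum_cat x _ m n') ?mm ?(leq_trans mn) //.
rewrite (sqsum_cat x m n n') ?mn //.
by rewrite addrCA addrAC subrr add0r; apply: posD; exact: pos_sqsum.
Qed.

(** The difference is star d * d / t for d = t a - b. *)
Lemma star_mulD_le (a b : A) t : 0 < t ->
  pos (sc (1 + t) * (star a * a) + sc (1 + t^-1) * (star b * b)
       - star (a + b) * (a + b)).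
Proof.
move=> t0; pose d := sc t * a - b.
have := posM t^-1 (star d * d); rewrite invr_ge0 (ltW t0) => /(_ isT (pos_star_mul d)).
congr (pos _); set p := star a * a; set q := star b * b.
have -> : star (a + b) * (a + b) = (p + q) + (star a * b + star b * a).
  by rewrite starD mulrDl !mulrDr (AC (2*2) ((1*4)*(2*3))).
set w := star a * b + star b * a.
have -> : star d * d = sc t * (sc t * p - w) + q.
  rewrite /d starB starM star_sc scC mulrBl !mulrBr !mul_scA -mulrA opprB.
  rewrite -mulrA [X in X = _](AC (2*2) (((1*2)*4)*3)) /=; congr (_ + _).
  by rewrite /w mulrDr opprD addrA.
rewrite mulrDr scMA mulVf ?lt0r_neq0 // sc1M !scD !mulrDl !sc1M.
rewrite [X in _ = X - _]addrACA [- (p + q + w)]opprD [RHS]addrACA subrr add0r.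
by rewrite addrAC.
Qed.

(** The inequality star_mulD_le, summed over the block, gives
    |x + y|^2 <= (1 + t) |x|^2 + (1 + 1/t) |y|^2 for all t > 0; the infimum of the
    right-hand side over t is (|x| + |y|)^2. *)
Lemma wnormD x y m n : wnorm (x + y) m n <= wnorm x m n + wnorm y m n.
Proof.
have le t : 0 < t -> cnorm (sqsum (x + y) m n) <=
    (1 + t) * cnorm (sqsum x m n) + (1 + t^-1) * cnorm (sqsum y m n).
  move=> t0; have t1 : 0 <= 1 + t by rewrite addr_ge0 // ltW.
  have t2 : 0 <= 1 + t^-1 by rewrite addr_ge0 // invr_ge0 ltW.
  rewrite -{1}(ger0_norm t1) -{1}(ger0_norm t2) -!cnorm_scM.
  apply: le_trans _ (cnormD _ _); apply: pos_cnorm_le; first exact: pos_sqsum.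
  rewrite /sqsum !mulr_sumr -big_split /= -sumrB.
  apply: (big_ind pos) => [|h k|j _]; first by rewrite -sc0; exact: pos_sc.
    exact: posD.
  exact: star_mulD_le.
apply/ler_addgt0Pr => e e0; rewrite [wnorm (x + y) m n]/wnorm.
have a0 := wnorm_ge0 x m n; have b0 := wnorm_ge0 y m n.
rewrite -[cnorm (sqsum x m n)]wnorm_sqr -[cnorm (sqsum y m n)]wnorm_sqr in le.
move: (wnorm x m n) (wnorm y m n) a0 b0 le => a b a0 b0 le.
(* The optimal t is b / a; the e-shift covers the case a = 0 or b = 0. *)
pose a' := a + e / 2; pose b' := b + e / 2.
have e2 : 0 < e / 2 by rewrite divr_gt0.
have a'0 : 0 < a' by rewrite ltr_wpDl.
have b'0 : 0 < b' by rewrite ltr_wpDl.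
have -> : a + b + e = a' + b' by rewrite /a' /b'; lra.
have s0 : 0 <= a' + b' by rewrite addr_ge0 // ltW.
rewrite -(ger0_norm s0) -sqrtr_sqr ler_sqrt ?sqr_ge0 //.
apply: le_trans (le (b' / a') _) _; first exact: divr_gt0.
have -> : (a' + b') ^+ 2 = (1 + b' / a') * a' ^+ 2 + (1 + (b' / a')^-1) * b' ^+ 2.
  by field; rewrite !lt0r_neq0.
by rewrite lerD // ler_wpM2l ?addr_ge0 ?invr_ge0 ?divr_ge0 ?(ltW a'0) ?(ltW b'0) //
  ler_pXn2r ?nnegrE ?(ltW a'0) ?(ltW b'0) // lerDl ltW.
Qed.

Lemma wnormN x m n : wnorm (- x) m n = wnorm x m n.
Proof.
rewrite /wnorm /sqsum; congr (Num.sqrt (cnorm _)).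
by apply: eq_bigr => j _; rewrite /= starN mulrNN.
Qed.

Lemma wnorm_act x a m n : wnorm (l2act x a) m n <= wnorm x m n * cnorm a.
Proof.
rewrite -(ger0_norm (cnorm_ge0 a)) -sqrtr_sqr -sqrtrM ?cnorm_ge0 //.
rewrite ler_sqrt ?mulr_ge0 ?sqr_ge0 ?cnorm_ge0 //.
have -> : sqsum (l2act x a) m n = star a * sqsum x m n * a.
  rewrite /sqsum mulr_sumr mulr_suml; apply: eq_bigr => j _.
  by rewrite /l2act starM !mulrA.
apply: le_trans (cnormM _ _) _; rewrite expr2 mulrA ler_wpM2r ?cnorm_ge0 //.
by apply: le_trans (cnormM _ _) _; rewrite cnorm_star mulrC.
Qed.

Lemma wnorm1 x j : wnorm x j j.+1 = cnorm (x j).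
Proof.
by rewrite /wnorm /sqsum big_nat1 cnorm_star_mul sqrtr_sqr ger0_norm ?cnorm_ge0.
Qed.

Lemma l2_tailP x : l2 x <->
  forall e, 0 < e -> exists N, forall n, (N <= n)%N -> wnorm x N n < e.
Proof.
have ser N n : (N <= n)%N ->
    series (fun j => star (x j) * x j) n - series (fun j => star (x j) * x j) N
    = sqsum x N n.
  by move=> Nn; rewrite sub_series_geq.
have lt N n e : 0 < e -> (wnorm x N n < e) = (cnorm (sqsum x N n) < e ^+ 2).
  by move=> e0; rewrite -wnorm_sqr ltr_pXn2r // nnegrE ?wnorm_ge0 ?(ltW e0).
split=> [h e e0|h].
  have [|N HN] := cvg_cnorm_cauchy _ h (e ^+ 2); first by rewrite exprn_gt0.
  by exists N => n Nn; rewrite lt // -ser // HN.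
apply: cauchy_cnorm_cvg => e e0.
have [|N HN] := h (Num.sqrt e); first by rewrite sqrtr_gt0.
exists N => n Nn; rewrite ser //; have := HN n Nn.
by rewrite lt ?sqrtr_gt0 // sqr_sqrtr // ltW.
Qed.

Lemma l2norm_leP x c : l2 x -> (forall n, wnorm x 0 n <= c) <-> l2norm x <= c.
Proof.
move=> xl; have /cvg_cnormP cx := xl.
have serE n : series (fun j => star (x j) * x j) n = sqsum x 0 n by [].
split=> h.
  have c0 : 0 <= c := le_trans (wnorm_ge0 x 0 0) (h 0%N).
  rewrite /l2norm -(ger0_norm c0) -sqrtr_sqr ler_sqrt ?sqr_ge0 //.
  apply/ler_addgt0Pr => e /cx[N /(_ N (leqnn _)) /ltW HN].
  rewrite -(subrK (sqsum x 0 N) (l2inner x x)) addrC.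
  apply: le_trans (cnormD _ _) _; rewrite lerD //.
  by rewrite -wnorm_sqr ler_pXn2r ?nnegrE ?wnorm_ge0.
move=> n; apply: le_trans _ h; rewrite /l2norm ler_sqrt ?cnorm_ge0 //.
apply/ler_addgt0Pr => e /cx[N HN].
have Nm : (N <= maxn N n)%N := leq_maxl _ _.
have /ltW := HN _ Nm; rewrite serE => Hm.
apply: le_trans (_ : cnorm (sqsum x 0 (maxn N n)) <= _).
  rewrite -!wnorm_sqr ler_pXn2r ?nnegrE ?wnorm_ge0 //.
  exact: wnorm_le (leq_maxr _ _).
rewrite -[sqsum x 0 _](subKr (l2inner x x)).
by apply: le_trans (cnormB _ _) _; rewrite lerD2l.
Qed.

Lemma wnorm_le_l2norm x m n : l2 x -> wnorm x m n <= l2norm x.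
Proof.
move=> xl; apply: le_trans (wnorm_le x m n 0 n (leq0n _) (leqnn _)) _.
by move: n; apply/(l2norm_leP _ _ xl).
Qed.

Lemma l2norm_ge0 x : 0 <= l2norm x.
Proof. exact: sqrtr_ge0. Qed.

Lemma cnorm_coord x j : l2 x -> cnorm (x j) <= l2norm x.
Proof. by move=> xl; rewrite -wnorm1; exact: wnorm_le_l2norm. Qed.

Lemma l2D x y : l2 x -> l2 y -> l2 (x + y).
Proof.
move=> /l2_tailP hx /l2_tailP hy; apply/l2_tailP => e e0.
have e2 : 0 < e / 2 by rewrite divr_gt0.
have [N HN] := hx _ e2; have [M HM] := hy _ e2.
exists (maxn N M) => n; rewrite geq_max => /andP[Nn Mn].
apply: le_lt_trans (wnormD _ _ _ _) _; rewrite [ltRHS]splitr ltrD //.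
  by apply: le_lt_trans (HN n Nn); rewrite wnorm_le // leq_maxl.
by apply: le_lt_trans (HM n Mn); rewrite wnorm_le // leq_maxr.
Qed.

Lemma l2N x : l2 x -> l2 (- x).
Proof.
move=> /l2_tailP hx; apply/l2_tailP => e /hx[N HN].
by exists N => n /HN; rewrite wnormN.
Qed.

Lemma l2B x y : l2 x -> l2 y -> l2 (x - y).
Proof. by move=> hx hy; apply: l2D => //; exact: l2N. Qed.

Lemma l2_act x a : l2 x -> l2 (l2act x a).
Proof.
move=> /l2_tailP hx; apply/l2_tailP => e e0.
have c0 : 0 < cnorm a + 1 by rewrite ltr_wpDl ?cnorm_ge0.
have [|N HN] := hx (e / (cnorm a + 1)); first by rewrite divr_gt0.
exists N => n /HN; rewrite ltr_pdivlMr //; apply: le_lt_trans.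
by apply: le_trans (wnorm_act _ _ _ _) _; rewrite ler_wpM2l ?wnorm_ge0 // lerDl.
Qed.

Lemma l2normD x y : l2 x -> l2 y -> l2norm (x + y) <= l2norm x + l2norm y.
Proof.
move=> hx hy; apply/l2norm_leP; first exact: l2D.
by move=> n; apply: le_trans (wnormD _ _ _ _) _; rewrite lerD ?wnorm_le_l2norm.
Qed.

Lemma l2normN x : l2norm (- x) = l2norm x.
Proof.
rewrite /l2norm /l2inner; congr (Num.sqrt (cnorm (limn (series _)))).
by apply/funext => j /=; rewrite starN mulrNN.
Qed.

Lemma l2normC x y : l2norm (x - y) = l2norm (y - x).
Proof. by rewrite -l2normN opprB. Qed.

Lemma l2norm_act x a : l2 x -> l2norm (l2act x a) <= l2norm x * cnorm a.
Proof.
move=> hx; apply/l2norm_leP; first exact: l2_act.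
move=> n; apply: le_trans (wnorm_act _ _ _ _) _.
by rewrite ler_wpM2r ?cnorm_ge0 ?wnorm_le_l2norm.
Qed.

Lemma l2_scaleE r x : r%:C *: x = l2act x (sc r).
Proof. by apply/funext => j; rewrite /l2act scC scM. Qed.

Lemma l2_scale r x : l2 x -> l2 (r%:C *: x).
Proof. by rewrite l2_scaleE; exact: l2_act. Qed.

Lemma l2norm_scale r x : l2 x -> 0 <= r -> l2norm (r%:C *: x) <= r * l2norm x.
Proof.
move=> hx r0; rewrite l2_scaleE; apply: le_trans (l2norm_act _ _ hx) _.
by rewrite cnorm_sc ger0_norm // mulrC.
Qed.

Lemma l2_eventually0 x k : (forall j, (k <= j)%N -> x j = 0) -> l2 x.
Proof.
move=> x0; apply/l2_tailP => e e0; exists k => n kn.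
rewrite /wnorm /sqsum big_nat_cond big1 ?cnorm0 ?sqrtr0 // => j /andP[/andP[kj _] _].
by rewrite x0 // mulr0.
Qed.

Lemma l20 : l2 (0 : nat -> A).
Proof. exact: (@l2_eventually0 _ 0). Qed.

Lemma l2norm0 : l2norm (0 : nat -> A) = 0.
Proof.
apply/le_anti; rewrite l2norm_ge0 andbT; apply/l2norm_leP; first exact: l20.
by move=> n; rewrite /wnorm /sqsum big1 ?cnorm0 ?sqrtr0 // => j _; rewrite mulr0.
Qed.

Lemma l2_sum n (x : 'I_n -> nat -> A) :
  (forall i, l2 (x i)) -> l2 (\sum_i x i).
Proof. by move=> hx; apply: (big_ind (@l2 R A)) => //; [exact: l20|exact: l2D]. Qed.

Lemma l2norm_sum n (x : 'I_n -> nat -> A) :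
  (forall i, l2 (x i)) -> l2norm (\sum_i x i) <= \sum_i l2norm (x i).
Proof.
move=> hx; suff [] : l2 (\sum_i x i) /\ l2norm (\sum_i x i) <= \sum_i l2norm (x i) by [].
elim/big_rec2: _ => [|i c z _ [zl zc]]; first by rewrite l2norm0; split=> //; exact: l20.
split; first exact: l2D.
by apply: le_trans (l2normD _ _ _ _) _ => //; rewrite lerD2l.
Qed.

(** The standard copy of A^k in l^2(A). *)
Definition coord_module k : set (nat -> A) :=
  [set x | forall j, (k <= j)%N -> x j = 0].

Definition trunc k x : nat -> A := fun j => if (j < k)%N then x j else 0.

Lemma trunc_coords k x : coord_module k (trunc k x).
Proof. by move=> j; rewrite /trunc leqNgt => /negbTE ->. Qed.

Lemma l2norm_trunc_lt x e : l2 x -> 0 < e ->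
  exists N, forall k, (N <= k)%N -> l2norm (x - trunc k x) <= e.
Proof.
move=> xl e0; have /l2_tailP /(_ e e0)[N HN] := xl; exists N => k Nk.
have xk : l2 (x - trunc k x).
  by apply: l2B => //; exact: l2_eventually0 (trunc_coords k x).
have tE j : (x - trunc k x) j = if (j < k)%N then 0 else x j.
  rewrite -[LHS]/(x j - trunc k x j) /trunc.
  by case: ifP => _; rewrite ?subrr ?subr0.
apply/l2norm_leP => // n.
apply: le_trans (_ : wnorm x k (maxn k n) <= _); last first.
  apply/ltW/(le_lt_trans _ (HN (maxn k n) _)); first exact: wnorm_le.
  by rewrite (leq_trans Nk) // leq_maxl.
apply: le_trans (wnorm_le _ 0 _ 0 (maxn k n) (leqnn _) (leq_maxr _ _)) _.
rewrite /wnorm (sqsum_cat _ 0 k) ?leq_maxl // [X in X + _]big_nat_cond.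
rewrite [X in X + _]big1 ?add0r => [|j /andP[/andP[_ jk] _]]; last first.
  by rewrite tE jk mulr0.
rewrite /sqsum (eq_big_nat _ _ (F2 := fun j => star (x j) * x j)) // => j.
by move=> /andP[kj _]; rewrite tE ltnNge kj.
Qed.
End L2.

(** * The measure of noncompactness *)

Section Lambda.
Local Open Scope complex_scope.
Context {R : realType} {A : cstarAlgType R}.
Implicit Types (E F M : set (nat -> A)) (x y z : nat -> A) (eta e : R).

Definition coord_embed n (u : 'rV[A]_n) : nat -> A :=
  fun j => if insub j is Some i then u 0 i else 0.

Lemma coord_embedE n (u : 'rV[A]_n) (i : 'I_n) : coord_embed _ u i = u 0 i.
Proof. by rewrite /coord_embed valK. Qed.

Lemma coord_embed_ge n (u : 'rV[A]_n) j : (n <= j)%N -> coord_embed _ u j = 0.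
Proof. by move=> nj; rewrite /coord_embed insubF // ltnNge nj. Qed.

(** Coordinates are norm-continuous by cnorm_coord, so vanishing of the
    coordinates from n on is a closed condition. *)
Lemma closed_submodule_coords n : closed_submodule (@coord_module R A n).
Proof.
split.
- by move=> x /l2_eventually0.
- by [].
- by move=> x y hx hy j nj; rewrite -[LHS]/(x j + y j) hx // hy // addr0.
- by move=> x a hx j nj; rewrite /l2act hx // mul0r.
- move=> x xl h j nj; apply: cnorm_eq0; apply/le_anti; rewrite cnorm_ge0 andbT.
  apply/ler_addgt0Pr => e /h[y hy /ltW xy]; rewrite add0r; apply: le_trans _ xy.
  have -> : x j = (x - y) j by rewrite -[RHS]/(x j - y j) hy // subr0.
  by apply: cnorm_coord; apply: l2B => //; exact: l2_eventually0 _ _ hy.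
Qed.

Lemma l2inner_coord_embed n (u v : 'rV[A]_n) :
  l2inner (coord_embed _ u) (coord_embed _ v) = free_inner u v.
Proof.
apply: cvg_lim; first exact: norm_hausdorff.
apply/cvg_cnormP => e e0; exists n => m nm.
suff -> : series (fun j => star (coord_embed _ u j) * coord_embed _ v j) m
    = free_inner u v by rewrite subrr cnorm0.
rewrite seriesEnat /= (big_cat_nat (leq0n n) nm) /= [X in _ + X]big_nat_cond.
rewrite [X in _ + X]big1 ?addr0 => [|j /andP[/andP[nj _] _]]; last first.
  by rewrite (coord_embed_ge _ v _ nj) mulr0.
by rewrite big_mkord; apply: eq_bigr => i _; rewrite !coord_embedE.
Qed.

Lemma free_fg_coords n : free_fg_submodule (@coord_module R A n).
Proof.
split; first exact: closed_submodule_coords.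
exists n, (coord_embed n); split; last exact: l2inner_coord_embed.
- split=> [u _ j|u v _ _ uv|x hx]; first exact: coord_embed_ge.
    by apply/rowP => i; rewrite -!coord_embedE uv.
  exists (\row_i x i) => //; apply/funext => j; case: (ltnP j n) => [jn|nj].
    by rewrite -[j]/(val (Ordinal jn)) coord_embedE mxE.
  by rewrite coord_embed_ge // hx.
- move=> u v; apply/funext => j; rewrite -[RHS]/(coord_embed _ u j + coord_embed _ v j).
  by rewrite /coord_embed; case: insubP => [i _ _|_]; rewrite ?mxE ?addr0.
- move=> u a; apply/funext => j; rewrite /l2act /coord_embed.
  by case: insubP => [i _ _|_]; rewrite ?mxE ?mul0r.
Qed.

Definition near_coords E eta : Prop := exists k, forall x, E x ->
  exists2 y, coord_module k y & l2norm (x - y) <= eta.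

Lemma coord_module_le m n : (m <= n)%N -> @coord_module R A m `<=` coord_module n.
Proof. by move=> mn x hx j nj; apply: hx; exact: leq_trans nj. Qed.

Lemma l2dist_le x M y : M y -> l2dist x M <= l2norm (x - y).
Proof.
move=> My; apply: ge_inf; last by exists y.
by exists 0 => _ [z _ <-]; exact: l2norm_ge0.
Qed.

Definition lambda_bounds E : set R := [set eta : R | 0 < eta /\
  exists2 M, free_fg_submodule M &
    (ereal_sup [set (l2dist x M)%:E | x in E] < eta%:E)%E].

Lemma lambda_bounds_near E eta eta' :
  near_coords E eta -> 0 <= eta -> eta < eta' -> lambda_bounds E eta'.
Proof.
move=> [k hk] eta0 lt; split; first exact: le_lt_trans lt.
exists (coord_module k); first exact: free_fg_coords.
apply: le_lt_trans (_ : _ <= eta%:E)%E _; last by rewrite lte_fin.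
apply: ge_ereal_sup => _ [x Ex <-]; have [y hy xy] := hk x Ex.
by rewrite lee_fin; apply: le_trans xy; exact: l2dist_le.
Qed.

Lemma has_lbound_lambda E : has_lbound (lambda_bounds E).
Proof. by exists 0 => eta [/ltW]. Qed.

Lemma lambda_le E eta : near_coords E eta -> 0 <= eta -> lambda E <= eta.
Proof.
move=> h eta0; apply/ler_addgt0Pr => e e0.
apply: ge_inf; first exact: has_lbound_lambda.
by apply: lambda_bounds_near _ _ _ h eta0 _; rewrite ltrDl.
Qed.

Lemma row_decomp n (u : 'rV[A]_n) : u = \sum_i free_act (delta_mx 0 i) (u 0 i).
Proof.
apply/rowP => j; rewrite summxE (bigD1 j) //= big1 => [|i ij].
  by rewrite !mxE !eqxx mul1r addr0.
by rewrite !mxE eqxx eq_sym (negbTE ij) mul0r.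
Qed.

Lemma cnorm_row_le n (u : 'rV[A]_n) i : cnorm (u 0 i) ^+ 2 <= cnorm (free_inner u u).
Proof.
rewrite -cnorm_star_mul; apply: pos_cnorm_le; first exact: pos_star_mul.
rewrite /free_inner (bigD1 i) //= addrAC subrr add0r.
apply: (big_ind pos) => [|h k|j _]; first by rewrite -sc0; exact: pos_sc.
  exact: posD.
exact: pos_star_mul.
Qed.

(** Write y = sum_i b_i u_i in the basis b_i of M.  Each |u_i| is at most |y| <= B
    because the isomorphism preserves the inner product, and each b_i is
    norm-close to its truncations; truncating all b_i at a common index moves y
    by an amount that is small uniformly over |y| <= B. *)
Lemma near_free_bounded M (B e : R) : free_fg_submodule M -> 0 < e ->
  exists k, forall y, M y -> l2norm y <= B ->
    exists2 z, coord_module k z & l2norm (y - z) <= e.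
Proof.
move=> [[Ml2 _ _ _ _] [n [f [[fM _ fsurj] fD fact finner]]]] e0.
pose b (i : 'I_n) := f (delta_mx 0 i).
have bl i : l2 (b i) by apply: Ml2; exact: fM.
have B0 : 0 < `|B| + 1 by rewrite ltr_wpDl.
(* The n truncation errors, each multiplied by |u_i|, must add up to at most e;
   the added units avoid dividing by 0. *)
pose d := e / (n%:R + 1) / (`|B| + 1).
have n0 : 0 < n%:R + 1 :> R by rewrite ltr_wpDl.
have d0 : 0 < d by rewrite !divr_gt0.
have /boolp.choice[N HN] (i : 'I_n) : exists N, forall k, (N <= k)%N ->
    l2norm (b i - trunc k (b i)) <= d by exact: l2norm_trunc_lt.
exists (\max_i N i)%N; set k := (\max_i N i)%N => y My yB.
have [u _ uy] := fsurj y My.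
have uB i : cnorm (u 0 i) <= `|B| + 1.
  apply: le_trans (_ : l2norm y <= _).
    rewrite /l2norm -uy finner -[leLHS]ger0_norm ?cnorm_ge0 // -sqrtr_sqr.
    by rewrite ler_sqrt ?cnorm_ge0 // cnorm_row_le.
  by apply: le_trans yB _; rewrite ler_wpDr // ler_norm.
have f0 : f 0 = 0 by apply: (@addrI _ (f 0)); rewrite -fD !addr0.
have yE : y = \sum_i l2act (b i) (u 0 i).
  rewrite -uy {1}(row_decomp _ u) (big_morph f fD f0).
  by apply: eq_bigr => i _; rewrite fact.
exists (\sum_i l2act (trunc k (b i)) (u 0 i)).
  have [_ c0 cD cact _] := closed_submodule_coords k.
  apply: (big_ind (coord_module k)) => // i _; apply: cact; exact: trunc_coords.
have tl i : l2 (b i - trunc k (b i)).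
  by apply: l2B => //; exact: l2_eventually0 _ _ (trunc_coords k (b i)).
rewrite yE -sumrB.
under eq_bigr => i _.
  have -> : l2act (b i) (u 0 i) - l2act (trunc k (b i)) (u 0 i) =
      l2act (b i - trunc k (b i)) (u 0 i).
    by apply/funext => j; rewrite /l2act -[RHS]/((b i j - trunc k (b i) j) * _) mulrBl.
  over.
apply: le_trans (l2norm_sum _ _ _) _; first by move=> i; exact: l2_act.
apply: le_trans (_ : \sum_(i < n) e / (n%:R + 1) <= _).
  apply: ler_sum => i _; apply: le_trans (l2norm_act _ _ (tl i)) _.
  have -> : e / (n%:R + 1) = d * (`|B| + 1) by rewrite /d divfK ?lt0r_neq0.
  by apply: ler_pM; rewrite ?l2norm_ge0 ?cnorm_ge0 // HN // leq_bigmax.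
rewrite sumr_const card_ord -[_ *+ n]mulr_natr mulrAC ler_pdivrMr //.
by rewrite ler_pM2l // lerDl.
Qed.

(** A point y of M within eta of x in E has norm at most C + eta, where C bounds
    E, so near_free_bounded applies uniformly in x. *)
Lemma near_coords_lambda_bounds E eta e : l2bounded E ->
  lambda_bounds E eta -> 0 < e -> near_coords E (eta + e).
Proof.
move=> [El2 [C EC]] [eta0 [M fM lt]] e0.
have [k hk] := near_free_bounded _ (C + eta) _ fM e0.
have Ml2 : M `<=` l2 by case: fM => -[].
exists k => x Ex.
have : l2dist x M < eta.
  by rewrite -lte_fin; apply: le_lt_trans lt; apply: ereal_sup_ubound; exists x.
move/inf_lt => []; last move=> _ [y My <-] /ltW xy.
  by exists (l2norm (x - 0)), 0 => //; case: fM => -[].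
have xl := El2 x Ex; have yl := Ml2 y My.
have [|z hz yz] := hk y My.
  have -> : y = x + (y - x) by rewrite addrC subrK.
  by apply: le_trans (l2normD _ _ xl (l2B _ _ yl xl)) _; rewrite lerD ?EC // l2normC.
exists z => //; rewrite -(subrKA y).
apply: le_trans (l2normD _ _ _ _) (lerD xy yz); apply: l2B => //.
exact: l2_eventually0 _ _ hz.
Qed.

Lemma lambda_bounds_neq0 E : l2bounded E -> lambda_bounds E !=set0.
Proof.
move=> [El2 [C EC]]; exists (`|C| + 1).
apply: (lambda_bounds_near _ `|C|) => //; last by rewrite ltrDl.
exists 0%N => x Ex; exists 0 => //; rewrite subr0.
exact: le_trans (EC x Ex) (ler_norm C).
Qed.

(** Together with lambda_le, this says that lambda E is the infimum of the
    nonnegative eta for which near_coords E eta holds. *)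
Lemma lambda_lt E eta : l2bounded E -> lambda E < eta -> near_coords E eta.
Proof.
move=> bE /inf_lt[]; first exact: lambda_bounds_neq0.
move=> eta' h lt; rewrite -(subrK eta' eta) addrC.
by apply: near_coords_lambda_bounds => //; rewrite subr_gt0.
Qed.

Lemma lambda_ge0 E : l2bounded E -> 0 <= lambda E.
Proof.
by move=> bE; apply: lb_le_inf => [|eta [/ltW]//]; exact: lambda_bounds_neq0.
Qed.

Lemma near_coords_add E e : l2bounded E -> 0 < e -> near_coords E (lambda E + e).
Proof. by move=> bE e0; apply: lambda_lt => //; rewrite ltrDl. Qed.

Lemma lambda_le_eps E c : 0 <= c ->
  (forall e, 0 < e -> near_coords E (c + e)) -> lambda E <= c.
Proof.
move=> c0 h; apply/ler_addgt0Pr => e e0.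
by apply: lambda_le; [exact: h | rewrite addr_ge0 // ltW].
Qed.

Lemma near_coords_le E eta eta' :
  eta <= eta' -> near_coords E eta -> near_coords E eta'.
Proof.
move=> le [k hk]; exists k => x /hk[y hy xy].
by exists y => //; exact: le_trans le.
Qed.

Lemma lambda_subset E F : l2bounded F -> E `<=` F -> lambda E <= lambda F.
Proof.
move=> bF EF; apply: lambda_le_eps => [|e e0]; first exact: lambda_ge0.
by have [k hk] := near_coords_add _ _ bF e0; exists k => x /EF /hk.
Qed.

Lemma lambda_setU E F : l2bounded E -> l2bounded F ->
  lambda (E `|` F) <= Num.max (lambda E) (lambda F).
Proof.
move=> bE bF; apply: lambda_le_eps => [|e e0]; first by rewrite le_max lambda_ge0.
have leE : lambda E + e <= Num.max (lambda E) (lambda F) + e.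
  by rewrite lerD2r le_max lexx.
have leF : lambda F + e <= Num.max (lambda E) (lambda F) + e.
  by rewrite lerD2r le_max lexx orbT.
have [k hk] := near_coords_le _ _ _ leE (near_coords_add _ _ bE e0).
have [l hl] := near_coords_le _ _ _ leF (near_coords_add _ _ bF e0).
exists (maxn k l) => x [/hk|/hl] [y hy xy]; exists y => //.
  by apply: coord_module_le hy; exact: leq_maxl.
by apply: coord_module_le hy; exact: leq_maxr.
Qed.

Lemma lambda_set_add E F : l2bounded E -> l2bounded F ->
  lambda (set_add E F) <= lambda E + lambda F.
Proof.
move=> bE bF; apply: lambda_le_eps => [|e e0]; first by rewrite addr_ge0 ?lambda_ge0.
have e2 : 0 < e / 2 by rewrite divr_gt0.
have [k hk] := near_coords_add _ _ bE e2.
have [l hl] := near_coords_add _ _ bF e2.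
have [El2 _] := bE; have [Fl2 _] := bF.
exists (maxn k l) => _ [x Ex [x' Fx' <-]].
have [y hy xy] := hk x Ex; have [y' hy' xy'] := hl x' Fx'.
have [_ _ cD _ _] := closed_submodule_coords (maxn k l).
exists (y + y').
  by apply: cD; [apply: coord_module_le hy; exact: leq_maxl
                |apply: coord_module_le hy'; exact: leq_maxr].
rewrite opprD addrACA; apply: le_trans (l2normD _ _ _ _) _.
- by apply: l2B; [exact: El2|exact: l2_eventually0 _ _ hy].
- by apply: l2B; [exact: Fl2|exact: l2_eventually0 _ _ hy'].
- by apply: le_trans (lerD xy xy') _; rewrite addrACA -splitr.
Qed.

Lemma l2actB x y (a : A) : l2act x a - l2act y a = l2act (x - y) a.
Proof. by apply/funext => j; rewrite /l2act -[RHS]/((x j - y j) * a) mulrBl. Qed.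

Lemma lambda_set_act E (a : A) : l2bounded E ->
  lambda (set_act E a) <= lambda E * cnorm a.
Proof.
move=> bE; have a0 := cnorm_ge0 a; have [El2 _] := bE.
apply: lambda_le_eps => [|e e0]; first by rewrite mulr_ge0 ?lambda_ge0.
have a1 : 0 < cnorm a + 1 by rewrite ltr_wpDl.
have [k hk] := near_coords_add _ (e / (cnorm a + 1)) bE (divr_gt0 e0 a1).
have [_ _ _ cact _] := closed_submodule_coords k.
exists k => _ [x Ex <-]; have [y hy xy] := hk x Ex; exists (l2act y a); first exact: cact.
rewrite l2actB; apply: le_trans (l2norm_act _ _ _) _.
  by apply: l2B; [exact: El2|exact: l2_eventually0 _ _ hy].
apply: le_trans (ler_wpM2r a0 xy) _; rewrite mulrDl lerD2l mulrAC.
by rewrite ler_pdivrMr // ler_pM2l // lerDl.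
Qed.

Lemma l2bounded_set_act E (a : A) : l2bounded E -> l2bounded (set_act E a).
Proof.
move=> [El2 [C EC]]; split; first by move=> _ [x Ex <-]; exact/l2_act/El2.
exists (C * cnorm a) => _ [x Ex <-].
by apply: le_trans (l2norm_act _ _ (El2 x Ex)) _; rewrite ler_wpM2r ?cnorm_ge0 ?EC.
Qed.

Lemma set_actK E (a b : A) : a * b = 1 -> set_act (set_act E a) b = E.
Proof.
move=> ab; have actK x : l2act (l2act x a) b = x.
  by apply/funext => j; rewrite /l2act -mulrA ab mulr1.
apply/seteqP; split=> [_ [_ [x Ex <-] <-]|x Ex]; first by rewrite actK.
by exists (l2act x a); [exists x|exact: actK].
Qed.

(** By set_actK, E is the image of set_act E a under the action of b. *)
Lemma lambda_le_set_act E (a b : A) : l2bounded E -> a * b = 1 ->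
  lambda E <= lambda (set_act E a) * cnorm b.
Proof.
move=> bE ab; rewrite -{1}(set_actK E _ _ ab).
exact/lambda_set_act/l2bounded_set_act.
Qed.

Lemma cnorm_unitary (a : A) : star a * a = 1 -> cnorm a = 1.
Proof.
move=> ua; have := cnorm_star_mul a; rewrite ua cnorm1 => /esym/eqP.
by rewrite sqrp_eq1 ?cnorm_ge0 // => /eqP.
Qed.

Lemma subset_co E : E `<=` co E.
Proof.
move=> x Ex; exists 1%N, (fun=> 1), (fun=> x); split=> //; first by rewrite big_ord1.
by rewrite big_ord1 (rmorph1 (real_complex R)) scale1r.
Qed.

Lemma l2norm_convex n (t : 'I_n -> R) (x : 'I_n -> nat -> A) c :
  (forall i, 0 <= t i) -> \sum_i t i = 1 -> (forall i, l2 (x i)) ->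
  (forall i, l2norm (x i) <= c) ->
  l2norm (\sum_i (t i)%:C *: x i) <= c.
Proof.
move=> t0 t1 xl xc; rewrite -[c]mul1r -t1 mulr_suml.
apply: le_trans (l2norm_sum _ _ _) _; first by move=> i; exact: l2_scale.
apply: ler_sum => i _; apply: le_trans (l2norm_scale _ _ (xl i) (t0 i)) _.
by rewrite ler_wpM2l.
Qed.

Lemma l2bounded_co E : l2bounded E -> l2bounded (co E).
Proof.
move=> [El2 [C EC]]; split.
  move=> _ [n [t [x [_ _ Ex ->]]]]; apply: l2_sum => i; exact/l2_scale/El2.
exists C => _ [n [t [x [t0 t1 Ex ->]]]].
by apply: l2norm_convex => // i; [exact: El2|exact: EC].
Qed.

Lemma lambda_co E : l2bounded E -> lambda (co E) = lambda E.
Proof.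
move=> bE; apply/le_anti; rewrite (lambda_subset E) ?andbT //; first last.
- exact: subset_co.
- exact: l2bounded_co.
have [El2 _] := bE; apply: lambda_le_eps => [|e e0]; first exact: lambda_ge0.
have [k hk] := near_coords_add _ _ bE e0.
have [_ c0 cD cact _] := closed_submodule_coords k.
exists k => _ [n [t [x [t0 t1 Ex ->]]]].
have /boolp.choice[y hy] (i : 'I_n) : exists y, coord_module k y /\
    l2norm (x i - y) <= lambda E + e by have [y] := hk _ (Ex i); exists y.
exists (\sum_i (t i)%:C *: y i).
  apply: (big_ind (coord_module k)) => // i _.
  by rewrite l2_scaleE; apply: cact; case: (hy i).
rewrite -sumrB; under eq_bigr do rewrite -scalerBr.
apply: l2norm_convex => // i; last by case: (hy i).
by apply: l2B; [exact: El2|case: (hy i) => /l2_eventually0].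
Qed.
End Lambda.

Theorem proposition2p2 (R : realType) (A : cstarAlgType R)
    (E F : set (nat -> A)) (hE : l2bounded E) (hF : l2bounded F) :
  (E `<=` F -> lambda E <= lambda F)
  /\ lambda (E `&` F) <= Num.min (lambda E) (lambda F)
  /\ lambda (E `|` F) <= Num.max (lambda E) (lambda F)
  /\ lambda (set_add E F) <= lambda E + lambda F
  /\ (forall a : A,
        lambda (set_act E a) <= lambda E * cnorm a
        /\ (forall b : A, a * b = 1 -> b * a = 1 ->
              (cnorm b)^-1 * lambda E <= lambda (set_act E a))
        /\ (unitary a -> lambda (set_act E a) = lambda E))
  /\ lambda (co E) = lambda E.
Proof.
split; first exact: lambda_subset.
split; first by rewrite le_min !lambda_subset // => x [].
split; first exact: lambda_setU.
split; first exact: lambda_set_add.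
split; last exact: lambda_co.
move=> a; split; first exact: lambda_set_act.
split=> [b ab _|[ua au]].
  have b0 : 0 < cnorm b.
    rewrite lt_neqAle cnorm_ge0 andbT eq_sym; apply/eqP => /cnorm_eq0 b0.
    by move/eqP: ab; rewrite b0 mulr0 eq_sym oner_eq0.
  by rewrite mulrC ler_pdivrMr // lambda_le_set_act.
apply/le_anti/andP; split.
  by rewrite -[leRHS]mulr1 -(cnorm_unitary a ua) lambda_set_act.
rewrite -[leRHS]mulr1 -(cnorm_unitary (star a)) ?starK //.
exact: lambda_le_set_act.
Qed.
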